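(* Let $\psi$ be a fixed MSOL formula (without free variables) and $K$ a fixed integer. There is an $O(n)$-time algorithm that, given an $n$-element matroid $\mathcal{M}$ together with a $K$-decomposition of $\mathcal{M}$, decides whether $\mathcal{M}$ satisfies $\psi$.
   Context: An MSOL formula for matroids is built from element variables and set variables (of elements) using negation, disjunction, conjunction, existential and universal quantification over element and set variables, the equality predicate, the membership predicate, and the independence predicate stating that a set of elements is independent in the matroid. A $K$-decomposition ($K\ge1$ an integer) of a matroid $\mathcal{M}$ is a rooted tree $\mathcal{T}$ such that the leaves of $\mathcal{T}$ correspond one-to-one to the elements of $\mathcal{M}$ and record whether the corresponding element is a loop, and each inner node $v$ has exactly two children and is equipped with functions $\varphi_v:\{0,\dots,K\}^2\to\{0,\dots,K\}$ and $\varphi_v^r:\{0,\dots,K\}^2\to\mathbb{N}$. For a subset $F$ of the ground set, color and label the nodes as follows: a leaf whose element is in $F$ gets color $1$, other leaves color $0$; a leaf whose element is in $F$ and is not a loop gets label $1$, other leaves label $0$; an inner node $v$ whose two children have colors $\gamma_1,\gamma_2$ and labels $\lambda_1,\lambda_2$ gets color $\varphi_v(\gamma_1,\gamma_2)$ and label $\lambda_1+\lambda_2-\varphi_v^r(\gamma_1,\gamma_2)$. It is required that for every $F$ the label of the root equals $r(F)$, and that for $F=\emptyset$ all nodes get color $0$ and label $0$. *)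

(* Defs.v *)
From mathcomp Require Import all_boot all_order all_algebra.
Set Implicit Arguments. Unset Strict Implicit. Unset Printing Implicit Defensive.

Record matroid (n : nat) := Matroid {
  indep : {set 'I_n} -> bool;
  indep0 : indep set0;
  indep_sub : forall A B : {set 'I_n}, B \subset A -> indep A -> indep B;
  indep_aug : forall A B : {set 'I_n}, indep A -> indep B -> #|A| < #|B| ->
                exists2 e, e \in B :\: A & indep (e |: A)
}.

Definition mrank n (M : matroid n) (F : {set 'I_n}) : nat :=
  \max_(I : {set 'I_n} | (I \subset F) && indep M I) #|I|.

Definition is_loop n (M : matroid n) (e : 'I_n) : bool := ~~ indep M [set e].

(* MSOL for matroids.  Element variables and set variables are both   *)
(* indexed by nat (two separate name spaces).                         *)
Inductive msol :=
| MEqE  (x y : nat)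
| MEqS  (X Y : nat)
| MMem  (x X : nat)
| MInd  (X : nat)
| MNot  (f : msol)
| MOr   (f g : msol)
| MAnd  (f g : msol)
| MExE  (x : nat) (f : msol)
| MAllE (x : nat) (f : msol)
| MExS  (X : nat) (f : msol)
| MAllS (X : nat) (f : msol) (* forall set X *).

Fixpoint closed_in (be bs : seq nat) (f : msol) : bool :=
  match f with
  | MEqE x y => (x \in be) && (y \in be)
  | MEqS X Y => (X \in bs) && (Y \in bs)
  | MMem x X => (x \in be) && (X \in bs)
  | MInd X => X \in bs
  | MNot g => closed_in be bs g
  | MOr g h | MAnd g h => closed_in be bs g && closed_in be bs h
  | MExE x g | MAllE x g => closed_in (x :: be) bs g
  | MExS X g | MAllS X g => closed_in be (X :: bs) g
  end.
Definition msol_sentence (f : msol) : bool := closed_in [::] [::] f.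

Definition upd {T : Type} (env : nat -> T) (i : nat) (v : T) : nat -> T :=
  fun j => if j == i then v else env j.

(* satisfaction; element environment is partial (unbound = None),
   set environment defaults to set0; irrelevant for sentences *)
Fixpoint msat n (M : matroid n) (ee : nat -> option 'I_n)
    (es : nat -> {set 'I_n}) (f : msol) : bool :=
  match f with
  | MEqE x y => match ee x, ee y with
                | Some a, Some b => a == b | _, _ => false end
  | MEqS X Y => es X == es Y
  | MMem x X => match ee x with Some a => a \in es X | None => false end
  | MInd X => indep M (es X)
  | MNot g => ~~ msat M ee es g
  | MOr g h => msat M ee es g || msat M ee es h
  | MAnd g h => msat M ee es g && msat M ee es h
  | MExE x g => [exists a : 'I_n, msat M (upd ee x (Some a)) es g]
  | MAllE x g => [forall a : 'I_n, msat M (upd ee x (Some a)) es g]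
  | MExS X g => [exists A : {set 'I_n}, msat M ee (upd es X A) g]
  | MAllS X g => [forall A : {set 'I_n}, msat M ee (upd es X A) g]
  end.

Definition models n (M : matroid n) (f : msol) : bool :=
  msat M (fun _ => None) (fun _ => set0) f.

(* Colors live in {0,...,K} = 'I_K.+1.                                *)
Inductive dtree (n K : nat) :=
| DLeaf (e : 'I_n) (isloop : bool)
| DNode (phi : {ffun 'I_K.+1 * 'I_K.+1 -> 'I_K.+1})
        (phir : {ffun 'I_K.+1 * 'I_K.+1 -> nat})
        (l r : dtree n K).

Fixpoint leaves n K (t : dtree n K) : seq 'I_n :=
  match t with
  | DLeaf e _ => [:: e]
  | DNode _ _ l r => leaves l ++ leaves r
  end.

Fixpoint leaves_loops_ok n K (M : matroid n) (t : dtree n K) : bool :=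
  match t with
  | DLeaf e b => b == is_loop M e
  | DNode _ _ l r => leaves_loops_ok M l && leaves_loops_ok M r
  end.

Fixpoint dcolor_label n K (F : {set 'I_n}) (t : dtree n K) : 'I_K.+1 * int :=
  match t with
  | DLeaf e b => (if e \in F then inord 1 else ord0,
                  if (e \in F) && ~~ b then Posz 1 else Posz 0)
  | DNode phi phir l r =>
      let (g1, l1) := dcolor_label F l in
      let (g2, l2) := dcolor_label F r in
      (phi (g1, g2), (l1 + l2 - Posz (phir (g1, g2)))%R)
  end.

Fixpoint all_nodes_zero n K (F : {set 'I_n}) (t : dtree n K) : Prop :=
  dcolor_label F t = (ord0, Posz 0) /\
  match t with
  | DLeaf _ _ => True
  | DNode _ _ l r => all_nodes_zero F l /\ all_nodes_zero F r
  end.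

Definition is_Kdecomposition n K (M : matroid n) (t : dtree n K) : Prop :=
  [/\ perm_eq (leaves t) (enum 'I_n),
      leaves_loops_ok M t,
      (forall F : {set 'I_n}, (dcolor_label F t).2 = Posz (mrank M F)) &
      all_nodes_zero set0 t].

Definition table_enc K (f : 'I_K.+1 * 'I_K.+1 -> nat) : seq nat :=
  [seq f (i, j) | i <- enum 'I_K.+1, j <- enum 'I_K.+1].

Fixpoint dtree_enc n K (t : dtree n K) : seq nat :=
  match t with
  | DLeaf e b => [:: 0; nat_of_ord e; nat_of_bool b]
  | DNode phi phir l r =>
      1 :: table_enc (fun p => nat_of_ord (phi p)) ++ table_enc (fun p => phir p)
        ++ dtree_enc l ++ dtree_enc r
  end.

Definition input_enc n K (t : dtree n K) : seq nat := n :: dtree_enc t.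

(* Unit-cost RAM.  Memory: nat -> nat; mem 0 holds the input length,  *)
(* mem 1.. the input; on halting the output is mem 0.                 *)
Inductive instr :=
| IConst (d c : nat)
| IAdd (d a b : nat)
| ISub (d a b : nat)
| ILoad (d a : nat)
| IStore (a b : nat)
| IJz (a l : nat)
| IHalt.

Definition program := seq instr.
Definition config := (nat * (nat -> nat))%type.

Definition ram_step (P : program) (c : config) : option config :=
  let: (pc, m) := c in
  match nth IHalt P pc with
  | IConst d k => Some (pc.+1, upd m d k)
  | IAdd d a b => Some (pc.+1, upd m d (m a + m b))
  | ISub d a b => Some (pc.+1, upd m d (m a - m b))
  | ILoad d a => Some (pc.+1, upd m d (m (m a)))
  | IStore a b => Some (pc.+1, upd m (m a) (m b))
  | IJz a l => Some (if m a == 0 then l else pc.+1, m)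
  | IHalt => None
  end.

Fixpoint ram_iter (P : program) (k : nat) (c : config) : option config :=
  match k with
  | 0 => Some c
  | k'.+1 => obind (ram_step P) (ram_iter P k' c)
  end.

Definition ram_init (input : seq nat) : config :=
  (0, fun a => if a is a'.+1 then nth 0 input a' else size input).

Definition ram_halts_within (P : program) (input : seq nat) (t out : nat) : Prop :=
  exists k c', [/\ k <= t, ram_iter P k (ram_init input) = Some c',
                   ram_step P c' = None & c'.2 0 = out].

(* Main.v *)
From HB Require Import structures.
Require Import Defs.
From mathcomp Require Import all_boot all_order all_algebra.
From mathcomp Require Import zify.
From Stdlib Require Import FunctionalExtensionality.

Set Implicit Arguments. Unset Strict Implicit. Unset Printing Implicit Defensive.

(* Since all [phir] values are natural numbers, the label of the root equals
   #|F| minus the number of loops in F minus the sum of the [phir] values used;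
   hence F is independent iff it contains no loop and only zero [phir] entries
   are used.  This is a finite-state condition on (color, zero test), so every
   MSOL formula is recognized by a bottom-up tree automaton over the tables
   (phi, phir == 0), quantifiers being handled by the subset construction.
   Such an automaton is evaluated in one left-to-right pass over the preorder
   encoding of the tree with a stack, and this pushdown evaluation compiles to
   a RAM program with a bounded number of instructions per input word. *)

(** * Tree automata on decompositions *)

Definition color_table K := {ffun 'I_K.+1 * 'I_K.+1 -> 'I_K.+1}.
Definition zero_table K := {ffun 'I_K.+1 * 'I_K.+1 -> bool}.

(** A leaf enters only through its loop flag and the variables that denote or contain its element, a
    node only through [phi] and the zero pattern of [phir]; nothing here depends on [n]. *)
Record automaton (K : nat) := Automaton {
  state : finType;
  at_leaf : bool -> (nat -> bool) -> (nat -> bool) -> state;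
  at_node : color_table K -> zero_table K -> state -> state -> state;
  accept : state -> bool
}.

Fixpoint run K (A : automaton K) n (ee : nat -> option 'I_n)
    (es : nat -> {set 'I_n}) (T : dtree n K) : state A :=
  match T with
  | DLeaf e b =>
      at_leaf A b (fun x => ee x == Some e) (fun X => e \in es X)
  | DNode phi phir l r =>
      at_node phi [ffun p => phir p == 0] (run A ee es l) (run A ee es r)
  end.

Definition recognizes K (A : automaton K) (f : msol) : Prop :=
  forall n (M : matroid n) (T : dtree n K) ee es, is_Kdecomposition M T ->
    accept (run A ee es T) = msat M ee es f.

(** This allows choices made separately in two subtrees with disjoint leaves to be merged. *)
Lemma eq_run K (A : automaton K) n (T : dtree n K)
    (ee ee' : nat -> option 'I_n) (es es' : nat -> {set 'I_n}) :
  {in leaves T, forall e x, (ee x == Some e) = (ee' x == Some e)} ->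
  {in leaves T, forall e X, (e \in es X) = (e \in es' X)} ->
  run A ee es T = run A ee' es' T.
Proof.
elim: T => [e b | phi phir l IHl r IHr] /= eqe eqs.
  by congr at_leaf; apply: functional_extensionality => x;
    [apply: eqe | apply: eqs]; rewrite mem_head.
by rewrite IHl ?IHr // => e le x; [apply: eqe | apply: eqs | apply: eqe | apply: eqs];
  rewrite mem_cat le ?orbT.
Qed.

Lemma updE T (env : nat -> T) i v j :
  upd env i v j = if j == i then v else env j.
Proof. by []. Qed.

Lemma leaves_uniq n K (M : matroid n) (T : dtree n K) :
  is_Kdecomposition M T -> uniq (leaves T).
Proof. by case=> /perm_uniq -> _ _ _; apply: enum_uniq. Qed.

Lemma mem_leaves n K (M : matroid n) (T : dtree n K) e :
  is_Kdecomposition M T -> e \in leaves T.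
Proof. by case=> /perm_mem -> _ _ _; rewrite mem_enum. Qed.

Definition not_aut K (A : automaton K) : automaton K :=
  Automaton (at_leaf A) (@at_node K A) (fun q => ~~ accept q).

Definition pair_aut K (op : bool -> bool -> bool) (A B : automaton K) :
    automaton K :=
  @Automaton K (state A * state B)%type
    (fun b a s => (at_leaf A b a s, at_leaf B b a s))
    (fun phi z p q => (at_node phi z p.1 q.1, at_node phi z p.2 q.2))
    (fun q => op (accept q.1) (accept q.2)).

Lemma run_not K (A : automaton K) n ee es (T : dtree n K) :
  run (not_aut A) ee es T = run A ee es T.
Proof. by elim: T => //= phi phir l -> r ->. Qed.

Lemma run_pair K op (A B : automaton K) n ee es (T : dtree n K) :
  run (pair_aut op A B) ee es T = (run A ee es T, run B ee es T).
Proof. by elim: T => //= phi phir l -> r ->. Qed.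

Definition has_aut K (p : (nat -> bool) -> (nat -> bool) -> bool) :
    automaton K :=
  @Automaton K bool (fun _ a s => p a s) (fun _ _ => orb) id.

Lemma run_has K p n ee es (T : dtree n K) :
  run (has_aut K p) ee es T =
  has (fun e => p (fun x => ee x == Some e) (fun X => e \in es X)) (leaves T).
Proof. by elim: T => /= [e b|phi phir l -> r ->]; rewrite ?orbF ?has_cat. Qed.

Definition indep_aut K (X : nat) : automaton K :=
  @Automaton K ('I_K.+1 * bool)%type
    (fun b _ s => (if s X then inord 1 else ord0, ~~ (s X && b)))
    (fun phi z p q => (phi (p.1, q.1), [&& p.2, q.2 & z (p.1, q.1)]))
    snd.

(** The defect [d] sums the loops of the set and the [phir] values used. A sum of natural numbers
    vanishes iff every term does, which is what the Boolean flag tracks. *)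
Lemma run_indep K X n ee es (T : dtree n K) :
  exists2 d : nat,
    run (indep_aut K X) ee es T = ((dcolor_label (es X) T).1, d == 0) &
    ((dcolor_label (es X) T).2 + Posz d)%R = Posz (count [in es X] (leaves T)).
Proof.
elim: T => [e b | phi phir l [d1 e1 c1] r [d2 e2 c2]] /=.
  by exists ((e \in es X) && b : nat); case: (e \in es X); case: b.
rewrite e1 e2 count_cat /= ffunE.
case: (dcolor_label _ l) e1 c1 => g1 l1 /= _ c1.
case: (dcolor_label _ r) e2 c2 => g2 l2 /= _ c2.
exists (d1 + d2 + phir (g1, g2)) => /=; last by lia.
by congr pair; rewrite !addn_eq0 andbA.
Qed.

Lemma mrank_leq_card n (M : matroid n) F : mrank M F <= #|F|.
Proof. by apply/bigmax_leqP => I /andP[sIF _]; apply: subset_leq_card. Qed.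

Lemma mrank_card n (M : matroid n) F : (mrank M F == #|F|) = indep M F.
Proof.
apply/eqP/idP => [rF | iF]; last first.
  apply/eqP; rewrite eqn_leq mrank_leq_card /=.
  by apply: (@leq_bigmax_cond _ _ (fun I : {set 'I_n} => #|I|) F); rewrite subxx.
have [|I /andP[sIF iI] rI] := @eq_bigmax_cond _
    [pred I : {set 'I_n} | (I \subset F) && indep M I] (fun I => #|I|).
  by apply/card_gt0P; exists set0; rewrite unfold_in /= sub0set indep0.
have -> // : F = I.
by apply/esym/eqP; rewrite eqEcard sIF -rF /mrank rI leqnn.
Qed.

(** At the root the label is the rank, so the defect is the cardinality of the set minus its
    rank. *)
Lemma recognizes_indep K X : recognizes (indep_aut K X) (MInd X).
Proof.
move=> n M T ee es dT /=; have [d -> /= dE] := run_indep X ee es T.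
case: (dT) => perm_T _ rT _.
have cE : count [in es X] (leaves T) = #|es X|.
  by rewrite (permP perm_T) cardE enumT -size_filter.
rewrite -mrank_card; move: dE; rewrite rT cE; have := mrank_leq_card M (es X).
lia.
Qed.

(** Subset construction: a leaf sees a single membership bit of [X], hence the two choices of
    [c]. *)
Definition set_aut K (X : nat) (ex : bool) (A : automaton K) : automaton K :=
  @Automaton K {set state A}
    (fun b a s => [set at_leaf A b a (upd s X c) | c : bool])
    (fun phi z S1 S2 => [set at_node phi z q1 q2 | q1 in S1, q2 in S2])
    (fun S => if ex then [exists q in S, accept q] else [forall q in S, accept q]).

Lemma run_set K X ex (A : automaton K) n ee es (T : dtree n K) :
  uniq (leaves T) ->
  run (set_aut X ex A) ee es T
    = [set run A ee (upd es X B) T | B : {set 'I_n}].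
Proof.
elim: T => [e b _ | phi phir l IHl r IHr] /=.
  apply/setP => q; apply/imsetP/imsetP => -[c _ ->].
    exists (if c then setT else set0) => //; congr at_leaf.
    apply: functional_extensionality => Y; rewrite !updE.
    by case: eqP => // _; case: c; rewrite inE.
  exists (e \in c) => //; congr at_leaf.
  by apply: functional_extensionality => Y; rewrite !updE; case: eqP.
rewrite cat_uniq => /and3P[ul /hasPn dis ur]; rewrite IHl // IHr //.
apply/setP => q; apply/imset2P/imsetP => [[q1 q2] | [B _ ->]]; last first.
  by exists (run A ee (upd es X B) l) (run A ee (upd es X B) r); rewrite ?imset_f.
case/imsetP => B1 _ -> /imsetP[B2 _ ->] ->.
(* As the subtrees share no leaf, [B1] and [B2] glue to one set with the same two values. *)
exists [set e | if e \in leaves l then e \in B1 else e \in B2] => //.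
congr at_node; apply: eq_run => // e le Y; rewrite !updE; case: eqP => // _.
  by rewrite inE le.
by rewrite inE (negPf (dis _ le)).
Qed.

Lemma recognizes_set K X ex (A : automaton K) f :
  recognizes A f ->
  recognizes (set_aut X ex A) (if ex then MExS X f else MAllS X f).
Proof.
move=> recA n M T ee es dT; rewrite run_set ?(leaves_uniq dT) //.
case: ex => /=.
  apply/existsP/existsP => [[_ /andP[/imsetP[B _ ->]]] | [B satB]].
    by rewrite (recA _ M) //; exists B.
  by exists (run A ee (upd es X B) T); rewrite imset_f // (recA _ M).
apply/forallP/forallP => [satq B | satB q].
  by have := satq (run A ee (upd es X B) T); rewrite imset_f // (recA _ M).
by apply/implyP => /imsetP[B _ ->]; rewrite (recA _ M).
Qed.

(* The Boolean component records whether the quantified element lies below the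
   current node. *)
Definition elt_aut K (x : nat) (ex : bool) (A : automaton K) : automaton K :=
  @Automaton K {set state A * bool}
    (fun b a s => [set (at_leaf A b (upd a x c) s, c) | c : bool])
    (fun phi z S1 S2 =>
       [set (at_node phi z u.1.1 u.2.1, u.1.2 || u.2.2)
          | u in setX S1 S2 & ~~ (u.1.2 && u.2.2)])
    (fun S => if ex then [exists q, ((q, true) \in S) && accept q]
              else [forall q, ((q, true) \in S) ==> accept q]).

(** [None] stands for an element outside the current subtree; by [eq_run] all such elements give the
    same value there. *)
Lemma run_elt K x ex (A : automaton K) n ee es (T : dtree n K) q c :
  uniq (leaves T) ->
  ((q, c) \in run (elt_aut x ex A) ee es T) <->
  exists o : option 'I_n, [/\ c = isSome o,
    (if o is Some a then a \in leaves T else true) &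
    q = run A (upd ee x o) es T].
Proof.
elim: T q c => [e b | phi phir l IHl r IHr] q c /=.
  move=> _; split.
    case/imsetP => d _ [-> ->]; exists (if d then Some e else None).
    split; [by case: d | by case: d; rewrite ?mem_head |].
    congr at_leaf; apply: functional_extensionality => y; rewrite !updE.
    by case: (y == x) => //; case: d; rewrite ?eqxx.
  case=> o [-> oe ->]; apply/imsetP; exists (isSome o) => //.
  congr pair; congr at_leaf; apply: functional_extensionality => y; rewrite !updE.
  by case: (y == x) => //; case: o oe => //= a; rewrite mem_seq1 => /eqP->; rewrite eqxx.
rewrite cat_uniq => /and3P[ul /hasPn dis ur].
have None_l a : a \notin leaves l ->
    run A (upd ee x (Some a)) es l = run A (upd ee x None) es l.
  move=> na; apply: eq_run => // e le y; rewrite !updE; case: (y == x) => //=.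
  by apply/eqP => -[ae]; rewrite -ae (negPf na) in le.
have None_r a : a \notin leaves r ->
    run A (upd ee x (Some a)) es r = run A (upd ee x None) es r.
  move=> na; apply: eq_run => // e le y; rewrite !updE; case: (y == x) => //=.
  by apply/eqP => -[ae]; rewrite -ae (negPf na) in le.
split.
  case/imsetP => -[[q1 c1] [q2 c2]]; rewrite inE /= in_setX /= -andbA.
  case/and3P => /IHl-/(_ ul)[o1 [-> m1 ->]] /IHr-/(_ ur)[o2 [-> m2 ->]] o12 [-> ->].
  (* The filter on flags rules out an element chosen on both sides. *)
  case: o1 o2 m1 m2 o12 => [a1|] [a2|] //= m1 m2 _.
  - exists (Some a1); split; rewrite ?mem_cat ?m1 // None_r //.
    by apply/negP => /dis /=; rewrite m1.
  - by exists (Some a2); split; rewrite ?mem_cat ?m2 ?orbT // None_l // dis.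
  - by exists None.
case=> -[a|] [-> /= mo ->].
  move: mo; rewrite mem_cat => /orP mo; apply/imsetP.
  case: mo => [al | ar].
    exists ((run A (upd ee x (Some a)) es l, true), (run A (upd ee x None) es r, false)).
      rewrite inE in_setX /= andbT; apply/andP; split.
        by apply/IHl => //; exists (Some a).
      by apply/IHr => //; exists None.
    by rewrite /= None_r //; apply/negP => /dis /=; rewrite al.
  exists ((run A (upd ee x None) es l, false), (run A (upd ee x (Some a)) es r, true)).
    rewrite inE in_setX /= andbT; apply/andP; split.
      by apply/IHl => //; exists None.
    by apply/IHr => //; exists (Some a).
  by rewrite /= None_l // dis.
apply/imsetP.
exists ((run A (upd ee x None) es l, false), (run A (upd ee x None) es r, false)) => //.
rewrite inE in_setX /= andbT; apply/andP; split.
  by apply/IHl => //; exists None.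
by apply/IHr => //; exists None.
Qed.

(** Every element is a leaf, so the pairs flagged [true] at the root are the values over all
    elements. *)
Lemma recognizes_elt K x ex (A : automaton K) f :
  recognizes A f ->
  recognizes (elt_aut x ex A) (if ex then MExE x f else MAllE x f).
Proof.
move=> recA n M T ee es dT; have uT := leaves_uniq dT.
case: ex => /=.
  apply/existsP/existsP => [[_ /andP[/run_elt-/(_ uT)[[a|] [] // _ _ ->]]] | [a sata]].
    by rewrite (recA _ M) //; exists a.
  exists (run A (upd ee x (Some a)) es T); rewrite (recA _ M) // sata andbT.
  by apply/run_elt => //; exists (Some a); rewrite (mem_leaves _ dT).
apply/forallP/forallP => [satq a | sata q].
  move/implyP: (satq (run A (upd ee x (Some a)) es T)); rewrite (recA _ M) //.
  by apply; apply/run_elt => //; exists (Some a); rewrite (mem_leaves _ dT).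
by apply/implyP => /run_elt-/(_ uT)[[a|] [] // _ _ ->]; rewrite (recA _ M).
Qed.

Lemma recognizes_not K (A : automaton K) f :
  recognizes A f -> recognizes (not_aut A) (MNot f).
Proof. by move=> recA n M T ee es dT; rewrite run_not /= (recA _ M). Qed.

Lemma msol_recognizable K (f : msol) : exists A : automaton K, recognizes A f.
Proof.
elim: f => [x y|X Y|x X|X|f [A rA]|f [A rA] g [B rB]|f [A rA] g [B rB]
  |x f [A rA]|x f [A rA]|X f [A rA]|X f [A rA]].
- exists (has_aut K (fun a _ => a x && a y)) => n M T ee es dT.
  rewrite /= run_has; apply/hasP/idP => [[e _ /andP[/eqP-> /eqP->]] // | ].
  case xa: (ee x) => [a|//]; case ya: (ee y) => [c|//] /eqP ac.
  by exists a; rewrite ?(mem_leaves _ dT) // ac eqxx.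
(* Two sets are equal iff no leaf lies in exactly one of them. *)
- exists (not_aut (has_aut K (fun _ s => s X != s Y))) => n M T ee es dT.
  rewrite run_not /= run_has; apply/hasPn/eqP => [eqXY | -> e _]; last by rewrite eqxx.
  by apply/setP => e; apply/eqP/negPn/eqXY/(mem_leaves _ dT).
- exists (has_aut K (fun a s => a x && s X)) => n M T ee es dT.
  rewrite /= run_has; apply/hasP/idP => [[e _ /andP[/eqP-> ->]] // | ].
  case xa: (ee x) => [a|//] aX.
  by exists a; rewrite ?(mem_leaves _ dT) // aX eqxx.
- by exists (indep_aut K X); apply: recognizes_indep.
- by exists (not_aut A); apply: recognizes_not.
- exists (pair_aut orb A B) => n M T ee es dT.
  by rewrite run_pair /= (rA _ M) // (rB _ M).
- exists (pair_aut andb A B) => n M T ee es dT.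
  by rewrite run_pair /= (rA _ M) // (rB _ M).
- by exists (elt_aut x true A); apply: (@recognizes_elt _ _ true).
- by exists (elt_aut x false A); apply: (@recognizes_elt _ _ false).
- by exists (set_aut X true A); apply: (@recognizes_set _ _ true).
- by exists (set_aut X false A); apply: (@recognizes_set _ _ false).
Qed.

(** * Compiling stack machines to RAM programs *)

(** The definition peels off the last step; simulation proceeds from the first. *)
Lemma ram_iterS P k c : ram_iter P k.+1 c = obind (ram_iter P k) (ram_step P c).
Proof.
elim: k c => [c|k IHk c]; first by rewrite /=; case: (ram_step P c).
by rewrite [LHS]/= -/(ram_iter P k.+1 c) IHk; case: (ram_step P c).
Qed.

Lemma ram_iterD P j k c :
  ram_iter P (j + k) c = obind (ram_iter P k) (ram_iter P j c).
Proof.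
elim: j c => [//|j IHj] c.
by rewrite addSn !ram_iterS; case: (ram_step P c).
Qed.

Inductive action (ctl sym : Type) :=
| Read (f : nat -> ctl)
| Push (g : sym) (s : ctl)
| Pop (f : sym -> ctl)
| Halt (b : bool).

(* The controls read an input word only up to truncation at [threshold], which
   keeps the branching of the compiled program bounded. *)
Record machine := Machine {
  control : finType;
  symbol : finType;
  threshold : nat;
  act : control -> action control symbol
}.

Definition mconfig M := (control M * seq (symbol M) * seq nat)%type.

Definition mstep M (c : mconfig M) : option (mconfig M) :=
  let: (s, stk, ws) := c in
  match act s with
  | Read f => if ws is x :: ws' then Some (f (minn x (threshold M)), stk, ws')
              else None
  | Push g s' => Some (s', g :: stk, ws)
  | Pop f => if stk is g :: stk' then Some (f g, stk', ws) else None
  | Halt _ => None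
  end.

Fixpoint miter M (k : nat) (c : mconfig M) : option (mconfig M) :=
  if k is k'.+1 then obind (miter k') (mstep c) else Some c.

Lemma miterD M j k (c : mconfig M) :
  miter (j + k) c = obind (miter k) (miter j c).
Proof. by elim: j c => [//|j IHj] c /=; case: (mstep c). Qed.

(* Registers of the compiled program: cell 0 holds the address of the top of the
   stack, which grows upwards from the end of the input; cell 1 holds a
   constant; cell 2 the address of the next input word; cell 3 is scratch.
   These cells overlap the input, but cell 1 contains [n], which is irrelevant,
   and the root tag in cell 2 is consumed by the preamble, which selects the
   start control [s0] or [s1] by it.  Both start controls must be reading ones,
   so that cell 3 is first written when the word it holds is read. *)
Definition dispatch (ts : seq nat) (d : nat) : seq instr :=
  flatten [seq [:: IJz 3 t; ISub 3 3 1] | t <- ts] ++ [:: IConst 1 0; IJz 1 d].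

Definition preamble_size := 11.

(** Bounds both the length of a block and the RAM steps simulating one machine step. *)
Definition block_size M := (threshold M + #|symbol M|).*2 + 10.

Definition address M (s : control M) : nat :=
  preamble_size + enum_rank s * block_size M.

(** Testing a cell just set to 0 is an unconditional jump. The default of [dispatch] serves words at
    or above [threshold] in [Read]; in [Pop] it is never reached, since the popped word is the rank
    of a symbol. *)
Definition block M (s : control M) : seq instr :=
  match act s with
  | Read f =>
      [:: IConst 1 1; ILoad 3 2; IAdd 2 2 1] ++
      dispatch [seq address (f j) | j <- iota 0 (threshold M)]
        (address (f (threshold M)))
  | Push g s' =>
      [:: IConst 1 1; IAdd 0 0 1; IConst 1 (enum_rank g); IStore 0 1;
          IConst 1 0; IJz 1 (address s')]
  | Pop f =>
      [:: IConst 1 1; ILoad 3 0; ISub 0 0 1] ++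
      dispatch [seq address (f g) | g <- enum (symbol M)] 0
  | Halt b => [:: IConst 0 b; IHalt]
  end.

Definition preamble M (g : symbol M) (s0 s1 : control M) : seq instr :=
  [:: IConst 1 1; IAdd 0 0 1; IConst 1 (enum_rank g); IStore 0 1;
      IJz 2 8; IConst 2 3; IConst 1 0; IJz 1 (address s1);
      IConst 2 3; IConst 1 0; IJz 1 (address s0)].

Definition compile M (g : symbol M) (s0 s1 : control M) : program :=
  preamble g s0 s1 ++
  mkseq (fun a => nth IHalt (nth [::] [seq block s | s <- enum (control M)]
                                 (a %/ block_size M)) (a %% block_size M))
        (#|control M| * block_size M).

Lemma size_dispatch ts d : size (dispatch ts d) = (size ts).*2 + 2.
Proof. by rewrite size_cat; congr addn; elim: ts => //= t ts ->. Qed.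

Lemma size_block M (s : control M) : size (block s) <= block_size M.
Proof.
rewrite /block /block_size; case: (act s) => [f|g s'|f|b] //=; try by lia.
  by rewrite size_dispatch size_map size_iota; lia.
by rewrite size_dispatch size_map -cardE; lia.
Qed.

Definition code_at (P : program) pc (code : seq instr) : Prop :=
  forall j, j < size code -> nth IHalt P (pc + j) = nth IHalt code j.

Lemma code_at_cons P pc i code :
  code_at P pc (i :: code) -> nth IHalt P pc = i /\ code_at P pc.+1 code.
Proof.
move=> codeP; split; first by rewrite -(addn0 pc) codeP.
by move=> j ltj; rewrite addSnnS codeP.
Qed.

Lemma compile_block M g0 (s0 s1 s : control M) :
  code_at (compile g0 s0 s1) (address s) (block s).
Proof.
move=> j /leq_trans/(_ (size_block s)) ltj.
have B0 : 0 < block_size M by rewrite /block_size addn_gt0 orbT.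
rewrite nth_cat (_ : size (preamble g0 s0 s1) = preamble_size) //.
rewrite /address -addnA ltnNge leq_addr /= addKn.
rewrite nth_mkseq.
  rewrite divnMDl // modnMDl divn_small // modn_small // addn0.
  by rewrite (nth_map s) ?nth_enum_rank // -cardE.
apply: leq_trans (_ : (enum_rank s).+1 * block_size M <= _).
  by rewrite mulSn addnC ltn_add2r.
by rewrite leq_mul2r ltn_ord orbT.
Qed.

(** Each target costs two instructions: leave if cell 3 is zero, otherwise decrement it by cell 1.
    Larger values fall through to [d]. *)
Lemma run_dispatch P ts d pc m :
  code_at P pc (dispatch ts d) -> m 1 = 1 ->
  exists k m', [/\ k <= (size ts).*2 + 2,
    ram_iter P k (pc, m) = Some (nth d ts (m 3), m') &
    forall a, a != 1 -> a != 3 -> m' a = m a].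
Proof.
elim: ts pc m => [|t ts IHts] pc m.
  move=> /code_at_cons[i0 /code_at_cons[i1 _]] _.
  exists 2, (upd m 1 0); split=> //; first by rewrite /= i0 /= i1 /= nth_nil.
  by move=> a /negPf a1 _; rewrite /upd a1.
move=> /code_at_cons[i0 /code_at_cons[i1 code_ts]] m1.
case m3: (m 3) => [|v].
  by exists 1, m; split=> //=; rewrite i0 m3.
have [|k [m' [lek itk m'E]]] := IHts pc.+2 (upd m 3 (m 3 - m 1)) code_ts.
  by rewrite /upd.
exists k.+2, m'; split=> [/=||a a1 a3]; first by lia.
  by rewrite -add2n ram_iterD /= i0 /= m3 /= i1 /= itk /upd /= m1 m3 subn1.
by rewrite m'E // /upd (negPf a3).
Qed.

(** Unread words end at cell [L] at the latest and the stack starts right above. Cell 3 may hold an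
    unread word only if the next action is a read, which loads it before using the cell as
    scratch. *)
Definition represents M (L : nat) (c : mconfig M) (rc : config) : Prop :=
  let: (s, stk, ws) := c in let: (pc, m) := rc in
  [/\ pc = address s, m 0 = L + size stk,
      (if act s is Read _ then 2 else 3) < m 2 /\ m 2 + size ws <= L.+1,
      forall i, i < size ws -> m (m 2 + i) = nth 0 ws i &
      forall i, i < size stk ->
        m (L + size stk - i) = nth 0 [seq enum_rank g : nat | g <- stk] i].

(** The condition [2 < L] keeps the stack, which starts at cell [L + 1], clear of the four
    registers. *)
Lemma represents_step M g0 (s0 s1 : control M) L (c c' : mconfig M) rc :
  2 < L -> mstep c = Some c' -> represents L c rc ->
  exists k rc', [/\ k <= block_size M,
    ram_iter (compile g0 s0 s1) k rc = Some rc' & represents L c' rc'].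
Proof.
case: c rc => [[s stk] ws] [pc m] L2 stepE [-> m0 [m2 m2L] wsE stkE].
have := @compile_block M g0 s0 s1 s; move: (compile g0 s0 s1) stepE => P.
rewrite /mstep /block; case: (act s) m2 => [f|g s'|f|b] // m2.
- case: ws m2L wsE => [|x ws] //= m2L wsE [<-].
  move=> /code_at_cons[i0 /code_at_cons[i1 /code_at_cons[i2 codeD]]].
  set m' := upd (upd (upd m 1 1) 3 (m (m 2))) 2 (m 2 + 1).
  have [|k [m'' [lek itk m''E]]] := run_dispatch (m := m') codeD; first by [].
  exists (3 + k), (address (f (minn x (threshold M))), m''); split.
  + by move: lek; rewrite size_map size_iota /block_size; lia.
  + rewrite ram_iterD /= i0 /= i1 /= i2.
    have -> : upd (upd m 1 1) 3 (upd m 1 1 (upd m 1 1 2))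
        = upd (upd m 1 1) 3 (m (m 2)).
      by rewrite /upd /= ifF //; lia.
    rewrite /= itk; congr (Some (_, _)).
    rewrite /m' /upd /= -[m 2]addn0 (wsE 0) //=.
    case: (ltnP x (threshold M)) => [ltx | lex].
      by rewrite (nth_map 0) ?size_iota // nth_iota.
    by rewrite nth_default // size_map size_iota.
  + split=> //.
    * by rewrite m''E.
    * by rewrite m''E // /m' /upd /=; case: (act (f _)); lia.
    * move=> i lti; have m'2 : m' 2 = m 2 + 1 by [].
      have /= <- := wsE i.+1 lti; rewrite (m''E 2) // m'2 m''E; try lia.
      rewrite /m' /upd !ifF; try lia.
      by congr m; lia.
    * move=> i lti; rewrite m''E; try lia.
      rewrite /m' /upd !ifF; try lia.
      exact: stkE.
- move=> [<-] /code_at_cons[i0 /code_at_cons[i1 /code_at_cons[i2 codeP]]].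
  case/code_at_cons: codeP => i3 /code_at_cons[i4 /code_at_cons[i5 _]].
  set m1 := upd (upd (upd m 1 1) 0 (m 0 + 1)) 1 (enum_rank g).
  exists 6, (address s', upd (upd m1 (m 0 + 1) (enum_rank g)) 1 0); split.
  + by rewrite /block_size; lia.
  + by rewrite /= i0 /= i1 /= i2 /= i3 /= i4 /= i5.
  (* The pushed word lands above [L], so below it only cells 0 and 1 change. *)
  + have upd_low a v : a <= L -> upd (upd m1 (m 0 + 1) v) 1 0 a
      = if a == 1 then 0 else if a == 0 then m 0 + 1 else m a.
      move=> aL; rewrite /m1 /upd; case: (a == 1) => //.
      by case: eqP => [|_]; [lia | case: eqP].
    split=> //.
    * by rewrite upd_low //= m0; lia.
    * by rewrite upd_low //=; case: (act s'); lia.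
    * move=> i lti; rewrite (upd_low 2) /=; last by lia.
      rewrite upd_low; last by lia.
      by rewrite !ifF ?wsE //; lia.
    * case=> [_|i] /=.
        by rewrite /upd /m1 ifF ?ifT //; lia.
      rewrite ltnS => lti; rewrite -stkE // /m1 /upd !ifF; try lia.
      by congr m; lia.
- case: stk m0 stkE => [|g stk] //= m0 stkE [<-].
  move=> /code_at_cons[i0 /code_at_cons[i1 /code_at_cons[i2 codeD]]].
  set m' := upd (upd (upd m 1 1) 3 (m (m 0))) 0 (m 0 - 1).
  have [|k [m'' [lek itk m''E]]] := run_dispatch (m := m') codeD; first by [].
  exists (3 + k), (address (f g), m''); split.
  + by move: lek; rewrite size_map -cardT /block_size; lia.
  + have m00 : m (m 0) = enum_rank g by have := stkE 0 isT; rewrite subn0 m0.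
    rewrite ram_iterD /= i0 /= i1 /= i2.
    have -> : upd (upd m 1 1) 3 (upd m 1 1 (upd m 1 1 0))
        = upd (upd m 1 1) 3 (m (m 0)).
      by rewrite /upd /= ifF //; lia.
    rewrite /= itk; congr (Some (_, _)).
    by rewrite /m' /upd /= m00 (nth_map g) ?nth_enum_rank // -cardE.
  + split=> //.
    * by rewrite m''E // /m' /upd /= m0; lia.
    * by rewrite m''E // /m' /upd /=; case: (act (f g)); lia.
    * move=> i lti; have m'2 : m' 2 = m 2 by [].
      rewrite -wsE // (m''E 2) // m'2 m''E; try lia.
      by rewrite /m' /upd !ifF //; lia.
    * move=> i lti; have /= <- := stkE i.+1 lti.
      rewrite m''E; try lia.
      rewrite /m' /upd !ifF; try lia.
      by congr m; lia.
Qed.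

(** Of the 9 extra steps, 8 run the preamble, on either branch, and one writes the output. *)
Lemma compile_correct M g0 (s0 s1 s : control M) f0 f1 input t b stk ws :
  2 < size input -> act s0 = Read _ f0 -> act s1 = Read _ f1 ->
  act s = Halt _ _ b ->
  miter t (if nth 0 input 1 == 0 then s0 else s1, [:: g0], drop 2 input)
    = Some (s, stk, ws) ->
  ram_halts_within (compile g0 s0 s1) input (9 + t * block_size M) b.
Proof.
set L := size input => L2 read0 read1 haltE.
set c0 := (_, [:: g0], _).
have [k0 [rc0 [le0 it0 rep0]]] : exists k rc, [/\ k <= 8,
    ram_iter (compile g0 s0 s1) k (ram_init input) = Some rc &
    represents L c0 rc].
  pose m := upd (upd (upd (upd (upd (upd (ram_init input).2 1 1) 0 (L + 1)) 1
    (enum_rank g0)) (L + 1) (enum_rank g0)) 2 3) 1 0.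
  exists 8, (address (if nth 0 input 1 == 0 then s0 else s1), m); split=> //.
    have L1_2 : (2 == L + 1) = false by lia.
    by rewrite /= /upd /= L1_2; case: (nth 0 input 1 == 0).
  split=> //=.
  - by rewrite /m /upd /= ifF //; lia.
  - have -> : m 2 = 3 by [].
    by case: ifP => _; rewrite ?read0 ?read1 size_drop; split=> //; rewrite -/L; lia.
  - move=> i; rewrite size_drop -/L => lti; rewrite nth_drop /m /upd /= !ifF //; lia.
  - case=> // _; rewrite subn0 /m /upd eqxx.
    by rewrite (_ : L + 1 == 1 = false) 1?(_ : L + 1 == 2 = false) //; lia.
have simul j (c : mconfig M) rc c' : represents L c rc -> miter j c = Some c' ->
    exists k rc', [/\ k <= j * block_size M,
                      ram_iter (compile g0 s0 s1) k rc = Some rc' &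
                      represents L c' rc'].
  elim: j c rc => [|j IHj] c rc repc /=.
    by move=> [<-]; exists 0, rc.
  case stepc: (mstep c) => [c1|] //= itj.
  have [k1 [rc1 [le1 it1 rep1]]] := represents_step g0 s0 s1 L2 stepc repc.
  have [k2 [rc2 [le2 it2 rep2]]] := IHj _ _ rep1 itj.
  by exists (k1 + k2), rc2; rewrite mulSn leq_add // ram_iterD it1.
move/(simul _ _ _ _ rep0) => [k [[pc m] [lek itk [pcE _ _ _ _]]]].
have := @compile_block M g0 s0 s1 s; rewrite /block haltE.
move: (compile g0 s0 s1) it0 itk => P it0 itk.
case/code_at_cons => i0 /code_at_cons[i1 _].
exists (k0 + (k + 1)), (pc.+1, upd m 0 b); split=> //.
- by lia.
- by rewrite ram_iterD it0 [obind _ _]/= ram_iterD itk /= pcE i0.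
- by rewrite /= pcE i1.
Qed.

(** * The machine evaluating an automaton on an encoded decomposition *)

Definition table_keys K : seq ('I_K.+1 * 'I_K.+1) :=
  [seq (i, j) | i <- enum 'I_K.+1, j <- enum 'I_K.+1].

Notation table_size K := (size (table_keys K)).

Lemma table_encE K (f : 'I_K.+1 * 'I_K.+1 -> nat) :
  table_enc f = [seq f p | p <- table_keys K].
Proof. by rewrite map_allpairs. Qed.

Lemma mem_table_keys K p : p \in table_keys K.
Proof. by case: p => i j; apply: allpairs_f; rewrite mem_enum. Qed.

(** Truncation at [K.+1] keeps colors exact and preserves whether a [phir] entry is zero. *)
Definition word_class K (x : nat) : 'I_K.+2 := inord (minn x K.+1).

Definition table_buffer K := {bseq (table_size K).*2 of 'I_K.+2}.

Lemma insub_bseqE n (T : Type) (s : seq T) :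
  size s <= n -> insub_bseq n s = s :> seq T.
Proof. by rewrite /insub_bseq val_insubd => ->. Qed.

Definition decode_colors K (w : seq 'I_K.+2) : color_table K :=
  [ffun p => inord (nth ord0 w (index p (table_keys K)))].

Definition decode_zeros K (w : seq 'I_K.+2) : zero_table K :=
  [ffun p => nth ord0 w (table_size K + index p (table_keys K)) == ord0].

Lemma decode_tables K (phi : color_table K)
    (phir : {ffun 'I_K.+1 * 'I_K.+1 -> nat}) :
  let w := [seq word_class K x | x <- table_enc (fun p => nat_of_ord (phi p))
                                   ++ table_enc (fun p => phir p)] in
  decode_colors w = phi /\ decode_zeros w = [ffun p => phir p == 0].
Proof.
rewrite /= !table_encE map_cat -!map_comp; split; apply/ffunP => p; rewrite !ffunE.
  rewrite nth_cat size_map index_mem mem_table_keys.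
  rewrite (nth_map p) ?index_mem ?mem_table_keys //= nth_index ?mem_table_keys //.
  rewrite /word_class (minn_idPl (ltnW (ltn_ord _))) inordK ?inord_val //.
  exact: ltnW (ltn_ord _).
rewrite nth_cat size_map ltnNge leq_addr /= addKn.
rewrite (nth_map p) ?index_mem ?mem_table_keys //= nth_index ?mem_table_keys //.
by rewrite /word_class -val_eqE /= inordK ?ltnS ?geq_minr //; lia.
Qed.

Definition node_symbol K : finType := (color_table K * zero_table K)%type.

Section Evaluator.

Variables (K : nat) (A : automaton K).

Inductive eval_control :=
| Tag
| LeafElement
| LeafLoop
| Table of table_buffer K
| PushRight of node_symbol K & state A
| Return of state A
| Finish of bool.

Definition eval_control_code (s : eval_control) :
    option (option (option (table_buffer K + node_symbol K * state A
                            + (state A + bool)))) :=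
  match s with
  | Tag => None
  | LeafElement => Some None
  | LeafLoop => Some (Some None)
  | Table w => Some (Some (Some (inl (inl w))))
  | PushRight g q => Some (Some (Some (inl (inr (g, q)))))
  | Return q => Some (Some (Some (inr (inl q))))
  | Finish b => Some (Some (Some (inr (inr b))))
  end.

Definition eval_control_decode c : eval_control :=
  match c with
  | None => Tag
  | Some None => LeafElement
  | Some (Some None) => LeafLoop
  | Some (Some (Some (inl (inl w)))) => Table w
  | Some (Some (Some (inl (inr (g, q))))) => PushRight g q
  | Some (Some (Some (inr (inl q)))) => Return q
  | Some (Some (Some (inr (inr b)))) => Finish b
  end.

Lemma eval_control_codeK : cancel eval_control_code eval_control_decode.
Proof. by case. Qed.

HB.instance Definition _ := Finite.copy eval_control (can_type eval_control_codeK).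

(* [None] marks the bottom of the stack; [Some (g, None)] waits for the value of
   the left subtree of a node with tables [g], and [Some (g, Some q)], where [q]
   is the value of the left subtree, for that of the right subtree. *)
Definition eval_symbol : finType := option (node_symbol K * option (state A)).

(** The value under the empty environment, in which no variable denotes or contains an element. *)
Definition leaf_value (b : bool) : state A :=
  at_leaf A b (fun _ => false) (fun _ => false).

(** Evaluation of a tree is stated from after its tag, because the preamble consumes the tag of the
    root. *)
Definition after_tag (x : nat) : eval_control :=
  if x == 0 then LeafElement else Table [bseq].

Definition eval_act (s : eval_control) : action eval_control eval_symbol :=
  match s with
  | Tag => Read _ after_tag
  | LeafElement => Read _ (fun _ => LeafLoop)
  | LeafLoop => Read _ (fun x => Return (leaf_value (x != 0)))
  | Table w =>
      if size w == (table_size K).*2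
      then Push (Some ((decode_colors w, decode_zeros w), None)) Tag
      else Read _ (fun x => Table (insub_bseq _ (rcons w (word_class K x))))
  | PushRight g q => Push (Some (g, Some q)) Tag
  | Return q =>
      Pop (fun y => match y with
        | None => Finish (accept q)
        | Some (g, None) => PushRight g q
        | Some (g, Some p) => Return (at_node g.1 g.2 p q)
        end)
  | Finish b => Halt _ _ b
  end.

Definition evaluator : machine :=
  @Machine eval_control eval_symbol K.+1 eval_act.

(** At a node, 2 counts a push and the left tag, 3 a pop, a push and the right tag, and 1 the final
    pop. The node's own tag is not counted. *)
Fixpoint eval_cost n (T : dtree n K) : nat :=
  match T with
  | DLeaf _ _ => 2
  | DNode _ _ l r =>
      (table_size K).*2 + (2 + (eval_cost l + (3 + (eval_cost r + 1))))
  end.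

(** Adding the bounds of two subtrees yields the additive constant twice; the surplus copy pays
    exactly for the parent. *)
Lemma eval_costP n (T : dtree n K) :
  eval_cost T + ((table_size K).*2 + 6) <=
  ((table_size K).*2 + 6).*2 * size (leaves T).
Proof.
elim: T => [e b | phi phir l IHl r IHr] /=; first by lia.
by rewrite size_cat mulnDr; lia.
Qed.

Lemma dtree_enc_cons n (T : dtree n K) :
  dtree_enc T = head 0 (dtree_enc T) :: behead (dtree_enc T).
Proof. by case: T. Qed.

Lemma after_tag_min x : after_tag (minn x K.+1) = after_tag x.
Proof. by rewrite /after_tag (_ : (minn x K.+1 == 0) = (x == 0)) //; lia. Qed.

Lemma read_table (w : table_buffer K) us stk ws :
  size w + size us = (table_size K).*2 ->
  exists2 w' : table_buffer K, w' = w ++ map (word_class K) us :> seq _ &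
    miter (size us) ((Table w, stk, us ++ ws) : mconfig evaluator)
      = Some (Table w', stk, ws).
Proof.
elim: us w => [|x us IHus] w /= size_w; first by exists w; rewrite ?cats0.
have wxE : insub_bseq (table_size K).*2 (rcons w (word_class K x))
    = rcons w (word_class K x) :> seq _.
  by apply: insub_bseqE; rewrite size_rcons; lia.
have [|w' w'E itw'] := IHus (insub_bseq _ (rcons w (word_class K x))).
  by rewrite wxE size_rcons; lia.
exists w'; first by rewrite w'E wxE cat_rcons.
rewrite ifF /=; last by lia.
(* The machine has already truncated the word; truncating again changes nothing. *)
have -> : word_class K (minn x K.+1) = word_class K x.
  by rewrite /word_class -minnA minnn.
exact: itw'.
Qed.

(** The arbitrary stack and remaining input let the induction hypothesis apply inside a larger
    tree. *)
Lemma eval_run n (T : dtree n K) stk ws :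
  miter (eval_cost T)
    ((after_tag (head 0 (dtree_enc T)), stk, behead (dtree_enc T) ++ ws)
       : mconfig evaluator)
  = Some (Return (run A (fun _ => None) (fun _ => set0) T), stk, ws).
Proof.
elim: T stk ws => [e b | phi phir l IHl r IHr] stk ws.
  rewrite /= /leaf_value; congr (Some (Return _, _, _)).
  have -> : (minn b K.+1 != 0) = b by case: b; lia.
  by congr at_leaf; apply: functional_extensionality => X; rewrite inE.
rewrite [eval_cost _]/= [after_tag _]/= [behead _]/= -!catA catA.
set us := (X in X ++ _).
have [] := @read_table [bseq] us stk (dtree_enc l ++ (dtree_enc r ++ ws)).
  by rewrite /us size_cat !table_encE !size_map addnn.
move=> w /= wE itw.
have -> : (table_size K).*2 = size us.
  by rewrite /us size_cat !table_encE !size_map addnn.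
rewrite miterD itw /= wE.
have [phiE phirE] := decode_tables phi phir.
rewrite size_map {1}/us size_cat !table_encE !size_map addnn eqxx /=.
rewrite phiE phirE (dtree_enc_cons l) /= add0n after_tag_min miterD IHl /=.
by rewrite (dtree_enc_cons r) /= add0n after_tag_min miterD IHr.
Qed.

End Evaluator.

(** * Linear-time model checking *)

Theorem theorem9 (psi : msol) (K : nat) :
  msol_sentence psi -> 0 < K ->
  exists (P : program) (c : nat),
    forall (n : nat) (M : matroid n) (T : dtree n K),
      is_Kdecomposition M T ->
      ram_halts_within P (input_enc T) (c * n.+1) (nat_of_bool (models M psi)).
Proof.
move=> _ _; have [A recA] := msol_recognizable K psi.
pose E := evaluator A; pose d := (table_size K).*2 + 6.
(* The start controls are the two values of [after_tag]; [d.*2] is the cost per leaf from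
   [eval_costP]. *)
exists (@compile E None (LeafElement A) (Table A [bseq])), (9 + d.*2 * block_size E).
move=> n M T dT.
(* Tables are nonempty, so [Table [bseq]] is a reading control, as [compile_correct] demands. *)
have tn0 : (0 == (table_size K).*2) = false.
  have := mem_table_keys (ord0 : 'I_K.+1, ord0 : 'I_K.+1).
  by case: (table_keys K).
(* The machine step beyond [eval_cost T] pops the bottom symbol [None] and enters [Finish]. *)
have [k [c' [lek itk haltk outk]]] : ram_halts_within
    (@compile E None (LeafElement A) (Table A [bseq])) (input_enc T)
    (9 + (eval_cost T + 1) * block_size E) (models M psi).
  apply: (@compile_correct E _ _ _
    (Finish A (accept (run A (fun _ => None) (fun _ => set0) T))) _ _ _ _ _ [::] [::]).
  - by case: (T) => //= *; rewrite size_cat table_encE size_map; lia.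
  - by [].
  - by rewrite /= tn0.
  - by rewrite /= (recA _ M).
  - rewrite miterD; have := @eval_run K A n T [:: None] [::].
    rewrite cats0 /input_enc [in drop _ _]dtree_enc_cons [in nth _ _ _]dtree_enc_cons.
    by rewrite /= drop0 => ->.
exists k, c'; split=> //; apply: leq_trans lek _.
have size_T : size (leaves T) = n.
  by case: dT => /perm_size -> _ _ _; rewrite size_enum_ord.
have le_cost : eval_cost T + 1 <= d.*2 * n.+1.
  by have := eval_costP T; rewrite size_T -/d mulnS /d; lia.
by rewrite [leqRHS]mulnDl leq_add ?leq_pmulr // mulnAC leq_mul2r le_cost orbT.
Qed.
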